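(* Let $\delta>0$, let $K\subset\mathbb{R}$ be a (possibly unbounded) interval, and let $K_4=\{x\in K\cap\delta\mathbb{Z} : x+4\delta\in K\cap\delta\mathbb{Z}\}$. For $x\in\mathbb{R}$ let $k(x)=\lfloor x/\delta\rfloor$. Let $\alpha^{k}_{k+i}:\mathbb{R}\to\mathbb{R}$ ($k\in\mathbb{Z}$, $i=0,1,2,3,4$) be the weights defined in the context. Given $f:K\cap\delta\mathbb{Z}\to\mathbb{R}$, the function $$Af(x)=\sum_{i=0}^{4}\alpha^{k(x)}_{k(x)+i}(x)\,f(\delta(k(x)+i)),\qquad x\in\mathrm{Conv}(K_4),$$ belongs to $C^3(\mathrm{Conv}(K_4))$ and is infinitely differentiable on $\mathrm{Conv}(K_4)\setminus K_4$. Furthermore, $$Af(\delta k)=f(\delta k),\qquad \delta k\in K_4,$$ and there exists a constant $C>0$ independent of $x$, $f$ and $\delta$ such that $$\Big|\frac{\partial^a}{\partial x^a}Af(x)\Big|\le C\delta^{-a}\max_{0\le i\le 4-a}\big|\Delta^a f(\delta(k(x)+i))\big|,\qquad x\in\mathrm{Conv}(K_4),\ 0\le a\le 3,$$ and this inequality also holds for $x\in\mathrm{Conv}(K_4)\setminus K_4$ when $a=4$. Additionally, the weights $\{\alpha^k_{k+i}: k\in\mathbb{Z},\ i=0,1,2,3,4\}$ are degree-$7$ polynomials in $(x-\delta k)/\delta$ whose coefficients do not depend on $k$ or $\delta$. They satisfy $$\alpha^k_k(\delta k)=1\quad\text{and}\quad \alpha^k_{k+i}(\delta k)=0,\qquad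 k\in\mathbb{Z},\ i=1,2,3,4,$$ $$\sum_{i=0}^{4}\alpha^k_{k+i}(x)=1,\qquad k\in\mathbb{Z},\ x\in\mathbb{R},$$ and the translational invariance property $$\alpha^{k+j}_{k+j+i}(x+\delta j)=\alpha^k_{k+i}(x),\qquad j,k\in\mathbb{Z},\ i\in\{0,1,2,3,4\},\ x\in\mathbb{R}.$$
   Context: $\delta\mathbb{Z}=\{\delta k:k\in\mathbb{Z}\}$ and $\mathrm{Conv}(B)$ is the convex hull of $B$. $C^3(B)$ is the set of three times continuously differentiable functions on $B$. For a function $f$ on (part of) $\delta\mathbb{Z}$, $\Delta f(\delta k)=f(\delta(k+1))-f(\delta k)$, $\Delta^0 f=f$, and $\Delta^{j+1}f(\delta k)=\Delta^j f(\delta(k+1))-\Delta^j f(\delta k)$. The zeroth derivative of a function is the function itself. Definition of the weights. For $k\in\mathbb{Z}$, $x\in\mathbb{R}$ put $t=(x-\delta k)/\delta$ and $$P_k(x)=f(\delta k)+t\big(\Delta-\tfrac12\Delta^2+\tfrac13\Delta^3\big)f(\delta k)+\tfrac12t^2\big(\Delta^2-\Delta^3\big)f(\delta k)+\tfrac16t^3\Delta^3f(\delta k)-\tfrac{23}{3}t^4\Delta^4f(\delta k)+\tfrac{41}{2}t^5\Delta^4f(\delta k)-\tfrac{55}{3}t^6\Delta^4f(\delta k)+\tfrac{11}{2}t^7\Delta^4f(\delta k).$$ Expanding the finite differences, $P_k(x)=\sum_{i=0}^4\alpha^k_{k+i}(x)f(\delta(k+i))$, and $\alpha^k_{k+i}(x)$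 is by definition the coefficient of $f(\delta(k+i))$ in this expression (it does not depend on $f$). *)

(* Defs.v *)
From HB Require Import structures.
From mathcomp Require Export all_boot all_order all_algebra.
From mathcomp Require Import ring.
From mathcomp Require Export all_classical all_reals all_analysis.
Export numFieldNormedType.Exports.
Set Implicit Arguments.
Unset Strict Implicit.
Unset Printing Implicit Defensive.
Import Order.TTheory GRing.Theory Num.Theory.
Local Open Scope classical_set_scope.
Local Open Scope ring_scope.

(* A function on (part of) the grid delta Z is represented by a total function
   R -> R; its values off the grid, or at grid points outside K, play no role. *)

Section Calculus.
Context {R : realType}.
Implicit Types (B : set R) (f : R -> R).

Definition Conv B : set R := smallest (@convex_set R R^o) B.

Definition diff_quot f (x y : R) : R := (f y - f x) / (y - x).

(* Derivatives are taken relative to B, hence one-sidedly at an end point of an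
   interval.  A point of B that is isolated in B carries no condition, and the
   derivative there is 0 by convention; this concerns only one-point intervals. *)
Definition derivable_in B f (x : R) : Prop :=
  cvg (diff_quot f x @ within B x^').

Definition derive_in B f (x : R) : R :=
  if `[< limit_point B x >] then lim (diff_quot f x @ within B x^') else 0.

Lemma derive_in_interior B f (x : R) : interior B x -> derive_in B f x = derive1 f x.
Proof.
rewrite /interior/= => Bx; have lpx : limit_point B x.
  move=> U Ux; have /nbhs_ballP[e /= e0 eBU] : nbhs x (B `&` U) by apply: filterI.
  have /eBU[] : ball x e (x + e / 2).
    rewrite /ball/= opprD addrA subrr add0r normrN gtr0_norm ?divr_gt0//.
    by rewrite ltr_pdivrMr// ltr_pMr// ltr1n.
  exists (x + e / 2); split => //.
  by rewrite -subr_eq0 addrAC subrr add0r mulf_neq0 ?gt_eqF// gt_eqF ?invr_gt0.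
rewrite /derive_in asboolT// /derive1; congr (lim _).
apply/seteqP; split=> P /=.
- move=> PB.
  have /nbhs_ballP[e /= e0 eP] : \forall y \near x, y != x -> P (diff_quot f x y).
    have PB' : \forall y \near x, y != x -> B y -> P (diff_quot f x y) := PB.
    by apply: filterS (filterI PB' Bx) => y [Py By] yx; exact: Py.
  apply/nbhs_ballP; exists e => //= h.
  rewrite /ball/= sub0r normrN => he h0.
  have := eP (h + x); rewrite /ball/= opprD addrCA subrr addr0 normrN he.
  rewrite /diff_quot -subr_eq0 addrK mulrC; exact.
- move=> /nbhs_ballP[e /= e0 eP]; apply/nbhs_ballP.
  exists e => //= y; rewrite /ball/= => ye yx _.
  have := eP (y - x); rewrite /ball/= sub0r opprB => /(_ ye).
  by rewrite subr_eq0 subrK /diff_quot [X in P X]mulrC; apply.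
Qed.

Definition deriven_in B (n : nat) f : R -> R := iter n (derive_in B) f.

Definition Cn_on (n : nat) B f : Prop :=
  (forall j, (j < n)%N -> forall x, B x -> derivable_in B (deriven_in B j f) x)
  /\ (forall j, (j <= n)%N -> {within B, continuous (deriven_in B j f)}).

Definition smooth_on B f : Prop := forall n, Cn_on n B f.

End Calculus.

Section Interpolation.
Context {R : realType}.
Implicit Types (delta x : R) (f : R -> R) (k j : int).

Definition grid delta : set R := range (fun k : int => delta * k%:~R).

Definition K4 delta (K : set R) : set R :=
  [set x | (K `&` grid delta) x /\ (K `&` grid delta) (x + 4 * delta)].

Definition fdiff delta f : R -> R := fun x => f (x + delta) - f x.

Definition fdiffn delta (n : nat) f : R -> R := iter n (fdiff delta) f.

Definition local_poly delta f k x : R :=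
  let t := (x - delta * k%:~R) / delta in
  let D n := fdiffn delta n f (delta * k%:~R) in
  f (delta * k%:~R)
  + t * (D 1 - 2^-1 * D 2 + 3^-1 * D 3)
  + 2^-1 * t ^+ 2 * (D 2 - D 3)
  + 6^-1 * t ^+ 3 * D 3
  - 23 / 3 * t ^+ 4 * D 4
  + 41 / 2 * t ^+ 5 * D 4
  - 55 / 3 * t ^+ 6 * D 4
  + 11 / 2 * t ^+ 7 * D 4.

(* weight delta k j is alpha^k_j, the coefficient of f (delta j) in local_poly,
   a linear form in the grid values of f: it is extracted by evaluating the form
   at the indicator function of the grid point delta j (see local_polyE). *)
Definition weight delta k j x : R :=
  local_poly delta (fun y => (y == delta * j%:~R)%:R) k x.

Definition cell delta x : int := Num.floor (x / delta).

Definition interp delta f x : R :=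
  let k := cell delta x in
  \sum_(i < 5) weight delta k (k + i%:Z) x * f (delta * (k + i%:Z)%:~R).

Lemma fdiffnE delta f k : let F (i : int) := f (delta * (k + i)%:~R) in
  [/\ fdiffn delta 1 f (delta * k%:~R) = F 1 - F 0,
      fdiffn delta 2 f (delta * k%:~R) = F 2 - 2 * F 1 + F 0,
      fdiffn delta 3 f (delta * k%:~R) = F 3 - 3 * F 2 + 3 * F 1 - F 0 &
      fdiffn delta 4 f (delta * k%:~R)
        = F 4 - 4 * F 3 + 6 * F 2 - 4 * F 1 + F 0].
Proof.
move=> F; rewrite /fdiffn /= /fdiff.
have E0 : delta * k%:~R = delta * (k + 0)%:~R by rewrite addr0.
have ES (i : int) : delta * (k + i)%:~R + delta = delta * (k + (i + 1))%:~R.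
  by rewrite addrA [in RHS]rmorphD /= mulrDr mulr1.
rewrite E0 !ES /F.
have -> : (0 + 1 : int) = 1 by [].
have -> : (1 + 1 : int) = 2 by [].
have -> : (2 + 1 : int) = 3 by [].
have -> : (3 + 1 : int) = 4 by [].
by split; ring.
Qed.

Lemma local_polyE delta f k x : delta != 0 ->
  local_poly delta f k x =
  \sum_(i < 5) weight delta k (k + i%:Z) x * f (delta * (k + i%:Z)%:~R).
Proof.
move=> d0; rewrite !big_ord_recr big_ord0 /= /weight /local_poly.
set t := (x - delta * k%:~R) / delta.
have E (i j : int) :
    (delta * (k + i)%:~R == delta * (k + j)%:~R :> R) = (i == j).
  by rewrite (inj_eq (mulfI d0)) eqr_int (inj_eq (addrI k)).
have E0 : delta * k%:~R = delta * (k + 0)%:~R by rewrite addr0.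
have [-> -> -> ->] := fdiffnE delta f k.
have W (i : int) := fdiffnE delta (fun y => (y == delta * (k + i)%:~R)%:R) k.
have [-> -> -> ->] := W 0; have [-> -> -> ->] := W 1.
have [-> -> -> ->] := W 2; have [-> -> -> ->] := W 3.
have [-> -> -> ->] := W 4.
rewrite E0 !E /= -E0; by field.
Qed.

End Interpolation.

(* Main.v *)
Require Import Defs.
From mathcomp Require Import ring lra.
Set Implicit Arguments.
Unset Strict Implicit.
Unset Printing Implicit Defensive.
Import Order.TTheory GRing.Theory Num.Theory.
Local Open Scope classical_set_scope.
Local Open Scope ring_scope.

(** Write t = (x - delta k) / delta and D_n = Delta^n f (delta k).  Grouping
    local_poly by differences rather than by powers of t gives
      P_k = D_0 c_0(t) + D_1 c_1(t) + D_2 c_2(t) + D_3 c_3(t) + D_4 c_4(t),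
    where, for n <= 3, c_n is the Newton polynomial
    t (t - 1) ... (t - n + 1) / n! and c_4 is the polynomial of degree 7 that
    vanishes to order 4 at t = 0 and agrees with c_3(t - 1) to order 4 at t = 1
    (these are eight Hermite conditions, which determine it).  With c_{-1} = 0,
    the family satisfies
      c_n(1 + s) = c_n(s) + c_{n-1}(s) + O(s^4),   0 <= n <= 4   (blend_step)
    by Pascal's rule for n <= 3 and by the choice of c_4 for n = 4.  As the
    differences at k + 1 are D_n + D_{n+1}, summation by parts turns this into
    the statement that P_k and P_{k+1} have the same derivatives up to order 3
    at delta (k + 1) (cell_poly_joined; the remaining term has the factor c_4,
    which is O(s^4)).  So Af is a polynomial on each cell, and consecutive
    pieces meet to third order: its derivatives up to order 3 are obtained
    piecewise, at every real point, and those of all orders are obtained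
    piecewise away from the grid (piecewise_diff_quot).

    For the bound on the derivative of order a, the polynomials c_n with n < a
    have degree n < a and disappear, while for n >= a the number D_n is a
    difference of order n - a of Delta^a f, hence at most 2^(n-a) times the
    largest of the values of |Delta^a f| in the bound.  The factors c_n^(a) are
    fixed polynomials evaluated on [0, 1], so the constant is universal
    (cell_poly_bound).

    Conv K_4 consists of the points that lie between two points of K_4.  If it
    has more than one point, all its points are limit points, and derivatives
    relative to it are the two-sided derivatives computed above; if it is a
    single point, the regularity is void and the derivatives of positive order
    are 0 (Conv_K4_dichotomy).  Removing K_4 leaves an open set, because K_4
    contains every grid point of Conv K_4 (off_K4_nbhs). *)

(** * Derivatives relative to a set *)

Section RelativeDerivatives.
Context {R : realType}.
Implicit Types (B : set R) (f g h : R -> R).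

Lemma diff_quot_eq_in B g h x : B x -> {in B, g =1 h} ->
  diff_quot g x @ within B x^' = diff_quot h x @ within B x^'.
Proof.
move=> Bx gh; suff E (u v : R -> R) : {in B, u =1 v} ->
    diff_quot v x @ within B x^' `=>` diff_quot u x @ within B x^'.
  by apply/seteqP; split; apply: E => // y By; rewrite gh.
move=> uv; apply: near_eq_cvg; rewrite near_withinE.
by apply: nearW => y By; rewrite /diff_quot !uv ?inE.
Qed.

Lemma derive_in_cvg B f x d : limit_point B x ->
  diff_quot f x @ x^' --> d -> derive_in B f x = d.
Proof.
move=> Bx fd; rewrite /derive_in asboolT//.
have PF : ProperFilter (within B x^').
  apply: Build_ProperFilter_ex => P.
  by move=> /Bx[y [yx By Py]]; exists y; exact: Py.
by apply: cvg_lim => //; exact: cvg_within_filter.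
Qed.

(** The derivatives relative to B are iterated as functions on the whole line,
    with arbitrary values off B; the induction can only identify them on B, and
    this is enough because the next difference quotient samples B alone. *)
Lemma deriven_in_next B f g n x d : {in B, deriven_in B n f =1 g} ->
    B x -> limit_point B x -> diff_quot g x @ x^' --> d ->
  deriven_in B n.+1 f x = d.
Proof.
move=> fg Bx limx gd; rewrite /deriven_in iterS -/(deriven_in B n f).
rewrite -(derive_in_cvg limx gd) /derive_in !asboolT//.
by rewrite (diff_quot_eq_in Bx fg).
Qed.

Lemma deriven_in_chain B (G : nat -> R -> R) n :
    (forall x, B x -> limit_point B x) ->
    (forall j x, (j < n)%N -> B x -> diff_quot (G j) x @ x^' --> G j.+1 x) ->
  forall j, (j <= n)%N -> {in B, deriven_in B j (G 0%N) =1 G j}.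
Proof.
move=> limB dG; elim=> [//|j IH jn x /[!inE] Bx].
exact: deriven_in_next (IH (ltnW jn)) Bx (limB _ Bx) (dG j x jn Bx).
Qed.

(** Reduces regularity on B to exhibiting a sequence G of ordinary two-sided
    successive derivatives. *)
Lemma Cn_on_chain B (G : nat -> R -> R) n :
    (forall x, B x -> limit_point B x) ->
    (forall j x, (j < n)%N -> B x -> diff_quot (G j) x @ x^' --> G j.+1 x) ->
    (forall j x, (j <= n)%N -> B x -> {for x, continuous (G j)}) ->
  Cn_on n B (G 0%N).
Proof.
move=> limB dG cG; have GE := deriven_in_chain limB dG; split=> j jn.
  move=> x Bx; rewrite /derivable_in (diff_quot_eq_in Bx (GE j (ltnW jn))).
  by apply/cvg_ex; exists (G j.+1 x); apply: cvg_within_filter; exact: dG.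
apply/subspace_continuousP => x Bx.
rewrite /from_subspace (GE j jn x (mem_set Bx)).
apply: cvg_trans (cvg_within_filter B (cG j x jn Bx)).
apply: near_eq_cvg; rewrite near_withinE.
by apply: nearW => y By; rewrite (GE j jn y (mem_set By)).
Qed.

Lemma Cn_on_subsingleton B f n : (forall x y, B x -> B y -> x = y) ->
  Cn_on n B f.
Proof.
move=> B1; split=> j _.
  move=> x Bx; apply/cvg_ex; exists 0 => U _; apply/nbhs_ballP.
  by exists 1 => //= y _ yx By; rewrite (B1 y x)// eqxx in yx.
apply/subspace_continuousP => x Bx U /nbhs_singleton Ux.
by apply: nearW => y By; rewrite /= (B1 y x).
Qed.

Lemma deriven_in_isolated B f x n : ~ limit_point B x ->
  deriven_in B n.+1 f x = 0.
Proof. by move=> Bx; rewrite /deriven_in iterS /derive_in asboolF. Qed.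

Lemma interior_limit_point B x : nbhs x B -> limit_point B x.
Proof.
move=> xB U xU; have : \forall y \near x^'+, [/\ y != x, B y & U y].
  near=> y; split; first by rewrite gt_eqF//; near: y; exact: nbhs_right_gt.
    by near: y; exact: cvg_within.
  by near: y; exact: cvg_within.
by move/filter_ex.
Unshelve. all: by end_near. Qed.

Lemma interval_limit_point B x c : is_interval B -> B x -> B c -> c != x ->
  limit_point B x.
Proof.
move=> iB Bx Bc; rewrite neq_lt => /orP[cx|xc] U xU.
- have : \forall y \near x^'-, [/\ y != x, B y & U y].
    near=> y; split; first by rewrite lt_eqF//; near: y; exact: nbhs_left_lt.
      apply: (iB c x) => //; apply/andP; split.
        by near: y; exact: nbhs_left_ge.
      by apply: ltW; near: y; exact: nbhs_left_lt.
    by near: y; exact: cvg_within.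
  by move/filter_ex.
- have : \forall y \near x^'+, [/\ y != x, B y & U y].
    near=> y; split; first by rewrite gt_eqF//; near: y; exact: nbhs_right_gt.
      apply: (iB x c) => //; apply/andP; split.
        by apply: ltW; near: y; exact: nbhs_right_gt.
      by near: y; exact: nbhs_right_le.
    by near: y; exact: cvg_within.
  by move/filter_ex.
Unshelve. all: by end_near. Qed.

End RelativeDerivatives.

(** * Convex hulls in the line *)

Section Hull.
Context {R : realType}.

(** The points squeezed between two points of A are already closed under convex
    combinations: the minimum and the maximum of the four bounds are in A. *)
Lemma Conv_betweenP (A : set R) x :
  Conv A x <-> exists a b, [/\ A a, A b & a <= x <= b].
Proof.
split.
- move=> /(_ [set x | exists a b, [/\ A a, A b & a <= x <= b]]); apply.
  split; last by move=> a Aa; exists a, a; rewrite lexx.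
  move=> u v l /[!inE] -[a [b [Aa Ab /andP[au ub]]]].
  move=> [c [d [Ac Ad /andP[cv vd]]]].
  have /andP[l0 l1] : 0 <= l%:num <= 1 by apply/andP.
  have E : conv l u v = l%:num * u + (1 - l%:num) * v :> R by [].
  have Am : A (Num.min a c) by rewrite /Num.min; case: ifP.
  have AM : A (Num.max b d) by rewrite /Num.max; case: ifP.
  exists (Num.min a c), (Num.max b d); split=> //.
  have mu : Num.min a c <= u by rewrite ge_min au.
  have mv : Num.min a c <= v by rewrite ge_min cv orbT.
  have uM : u <= Num.max b d by rewrite le_max ub.
  have vM : v <= Num.max b d by rewrite le_max vd orbT.
  rewrite E; apply/andP; split; nra.
- move=> [a [b [Aa Ab /andP[ax xb]]]] B [cB AB].
  move: ax xb; rewrite le_eqVlt => /predU1P[<- _|ax xb]; first exact: AB.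
  have ab : 0 < b - a by rewrite subr_gt0 (lt_le_trans ax).
  have l0 : 0 <= (b - x) / (b - a).
    by rewrite divr_ge0 ?subr_ge0// -subr_ge0 ltW.
  have l1 : (b - x) / (b - a) <= 1.
    by rewrite ler_pdivrMr// mul1r lerD2l lerN2 ltW.
  have := cB a b (Itv01 l0 l1); rewrite !inE => /(_ (AB _ Aa) (AB _ Ab)).
  set z := conv _ _ _; suff -> : z = x :> R by [].
  transitivity ((b - x) / (b - a) * a + (1 - (b - x) / (b - a)) * b).
    by [].
  by field; rewrite gt_eqF.
Qed.

End Hull.

(** * Piecewise polynomials on the cells of the grid *)

Section PiecewisePolynomials.
Context {R : realType}.
Variable delta : R.
Hypothesis delta0 : 0 < delta.
Implicit Types (q : int -> {poly R}) (x y : R).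

(** The difference quotient of p at x is itself a polynomial off x, namely the
    quotient of p - p(x) by X - x, whose value at x is the derivative. *)
Lemma diff_quot_horner (p : {poly R}) x :
  diff_quot (horner p) x @ x^' --> p^`().[x].
Proof.
have /factor_theorem[r pr] : root (p - p.[x]%:P) x.
  by rewrite rootE hornerD hornerN hornerC subrr.
have -> : p^`().[x] = r.[x].
  have := congr1 (fun s : {poly R} => s^`().[x]) pr.
  by rewrite /= !poly.derivE !hornerE subrr mulr0 add0r subr0.
apply: cvg_trans (cvg_within_filter _ (continuous_horner (p := r) (x := x))).
apply: near_eq_cvg; rewrite near_withinE; apply: nearW => y yx.
have -> : diff_quot (horner p) x y = (p - p.[x]%:P).[y] / (y - x).
  by rewrite hornerD hornerN hornerC.
by rewrite pr !hornerE mulfK// subr_eq0.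
Qed.

Lemma cell_itv x :
  delta * (cell delta x)%:~R <= x < delta * (cell delta x + 1)%:~R.
Proof.
have /andP[l r] := floor_itv (x / delta).
rewrite /cell; move: l r; rewrite ler_pdivlMr// ltr_pdivrMr// !(mulrC delta).
by move=> -> ->.
Qed.

Lemma cell_eq x k : delta * k%:~R <= x < delta * (k + 1)%:~R ->
  cell delta x = k.
Proof.
move=> /andP[l r]; apply: floor_def.
by rewrite ler_pdivlMr// ltr_pdivrMr// !(mulrC _ delta) l r.
Qed.

Lemma cell_knot k : cell delta (delta * k%:~R) = k.
Proof. by apply: cell_eq; rewrite lexx ltr_pM2l// ltr_int ltrDl. Qed.

(** Close to x only the cell of x is visible, and also the cell on its left if x
    is a grid point. *)
Lemma near_cell x : \forall y \near x, cell delta y = cell delta x \/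
  x = delta * (cell delta x)%:~R /\ cell delta y = cell delta x - 1.
Proof.
have /andP[kx xk] := cell_itv x.
have [xE|xE] := eqVneq x (delta * (cell delta x)%:~R).
- near=> y.
  have yk : y < delta * (cell delta x + 1)%:~R by near: y; exact: lt_nbhsl.
  have ky : delta * (cell delta x - 1)%:~R < y.
    near: y; apply: lt_nbhsr; rewrite [ltRHS]xE ltr_pM2l// ltr_int.
    by rewrite ltrBlDr ltrDl.
  have [yx|xy] := ltP y x; [right; split=> //|left]; apply: cell_eq.
    by rewrite (ltW ky) subrK -xE.
  by rewrite yk -xE xy.
- near=> y; left; apply: cell_eq; apply/andP; split.
    apply: ltW; near: y; apply: lt_nbhsr.
    by rewrite lt_neqAle eq_sym xE.
  by near: y; exact: lt_nbhsl.
Unshelve. all: by end_near. Qed.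

Definition piecewise q x : R := (q (cell delta x)).[x].

(** At a grid point the value is taken from the piece on the right, so only the
    piece on the left has to be compared.  The condition is void off the grid,
    which lets one lemma cover both grid points and interior points. *)
Definition joined_at x q : Prop := x = delta * (cell delta x)%:~R ->
  (q (cell delta x - 1)).[x] = (q (cell delta x)).[x].

Lemma piecewise_continuous q x : joined_at x q ->
  {for x, continuous (piecewise q)}.
Proof.
move=> qx U qU.
have cont p : p.[x] = (q (cell delta x)).[x] -> \forall y \near x, U p.[y].
  by move=> px; apply: (continuous_horner (p := p) (x := x)); rewrite px.
have right := cont _ erefl.
have left : \forall y \near x, x = delta * (cell delta x)%:~R ->
    U (q (cell delta x - 1)).[y].
  have [xE|xE] := pselect (x = delta * (cell delta x)%:~R); last first.
    by apply: filterE => y /xE.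
  by apply: filterS (cont _ (qx xE)).
apply: filterS (filterI (near_cell x) (filterI left right)) => y.
move=> [[yk|[xE yk]] [ly ry]]; rewrite /= /piecewise yk; first exact: ry.
exact: ly.
Qed.

(** Every difference quotient at x is a difference quotient of one of the two
    pieces that meet there, and both have the same limit. *)
Lemma piecewise_diff_quot q x : joined_at x q -> joined_at x (deriv \o q) ->
  diff_quot (piecewise q) x @ x^' --> piecewise (deriv \o q) x.
Proof.
move=> qx dqx U qU.
have cvp p : p^`().[x] = piecewise (deriv \o q) x ->
    \forall y \near x^', U (diff_quot (horner p) x y).
  by move=> px; apply: (diff_quot_horner (p := p) (x := x)); rewrite px.
have right := cvp (q (cell delta x)) erefl.
have left : \forall y \near x^', x = delta * (cell delta x)%:~R ->
    U (diff_quot (horner (q (cell delta x - 1))) x y).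
  have [xE|xE] := pselect (x = delta * (cell delta x)%:~R); last first.
    by apply: filterE => y /xE.
  by apply: filterS (cvp _ (dqx xE)).
have cells := nbhs_dnbhs (near_cell x).
apply: filterS (filterI cells (filterI left right)) => y.
move=> [[yk|[xE yk]] [ly ry]]; rewrite /= /diff_quot /piecewise yk.
  exact: ry.
by rewrite -(qx xE); exact: ly.
Qed.

Lemma joined_at_off_grid x q : ~ grid delta x -> joined_at x q.
Proof. by move=> xg xE; case: xg; exists (cell delta x). Qed.

End PiecewisePolynomials.

(** * The blending polynomials *)

Section Blend.
Context {R : realType}.
Implicit Types (delta x M : R) (f : R -> R) (k : int).

Lemma deriv_Poly (s : seq R) :
  (Poly s)^`() = Poly (mkseq (fun i => s`_i.+1 *+ i.+1) (size s).-1).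
Proof.
apply/polyP => i; rewrite coef_deriv !coef_Poly.
have [h|h] := ltnP i (size s).-1; first by rewrite nth_mkseq.
rewrite (@nth_default _ _ (mkseq _ _)) ?size_mkseq// nth_default ?mul0rn//.
by case: s h.
Qed.

(** The coefficient of the n-th difference in local_poly, as a polynomial in
    t: the Newton polynomial t (t - 1) ... (t - n + 1) / n! for n <= 3, and for
    n = 4 its Hermite substitute of degree 7. *)
Definition blend (n : nat) : {poly R} :=
  match n with
  | 0 => Poly [:: 1]
  | 1 => Poly [:: 0; 1]
  | 2 => Poly [:: 0; - 2^-1; 2^-1]
  | 3 => Poly [:: 0; 3^-1; - 2^-1; 6^-1]
  | _ => Poly [:: 0; 0; 0; 0; - (23 / 3); 41 / 2; - (55 / 3); 11 / 2]
  end.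

(** Pascal's rule c_n(t + 1) = c_n(t) + c_{n-1}(t), to third order at t = 0.  It
    is an exact identity for n <= 3, and for n = 4 it is what the degree 7
    buys. *)
Lemma blend_step j n : (j <= 3)%N -> (n < 5)%N ->
  (blend n)^`(j).[1] = (blend n)^`(j).[0]
     + (if n is m.+1 then (blend m)^`(j).[0] else 0).
Proof.
by case: j => [|[|[|[|//]]]] _; case: n => [|[|[|[|[|//]]]]] _;
   rewrite ?derivnS ?derivn0 /blend ?deriv_Poly !horner_Poly /=; field.
Qed.

Lemma blend4_flat j : (j <= 3)%N -> (blend 4)^`(j).[0] = 0.
Proof.
by case: j => [|[|[|[|//]]]] _;
   rewrite ?derivnS ?derivn0 /blend ?deriv_Poly !horner_Poly /=; ring.
Qed.

Lemma size_blend n : (n <= 3)%N -> (size (blend n) <= n.+1)%N.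
Proof.
by case: n => [|[|[|[|//]]]] _; apply: leq_trans (size_Poly _) _.
Qed.

Lemma size_blend4 : size (blend 4) = 8%N.
Proof. by rewrite (@PolyK _ 0)//= gt_eqF. Qed.

Lemma local_poly_blend delta f k x : local_poly delta f k x =
  \sum_(n < 5) fdiffn delta n f (delta * k%:~R)
                 * (blend n).[(x - delta * k%:~R) / delta].
Proof.
rewrite /local_poly !big_ord_recr big_ord0 /= !horner_cons hornerC.
(* The identity is polynomial in t; delta may be 0 here. *)
by move: (_ / delta) => t; field.
Qed.

Lemma fdiffnS_grid delta f n k : fdiffn delta n.+1 f (delta * k%:~R) =
  fdiffn delta n f (delta * (k + 1)%:~R) - fdiffn delta n f (delta * k%:~R).
Proof. by rewrite /fdiffn iterS /fdiff intrD mulrDr mulr1. Qed.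

(** * The pieces of the interpolant *)

Definition cell_poly delta f k : {poly R} :=
  \sum_(n < 5) fdiffn delta n f (delta * k%:~R)
     *: (blend n \Po (delta^-1 *: ('X - (delta * k%:~R)%:P))).

Lemma derivn_comp_affine (p : {poly R}) (a b : R) j :
  (p \Po (a *: ('X - b%:P)))^`(j) = a ^+ j *: (p^`(j) \Po (a *: ('X - b%:P))).
Proof.
elim: j => [|j IH]; first by rewrite expr0 scale1r.
rewrite derivnS IH derivZ deriv_comp derivZ derivXsubC derivnS.
by rewrite -alg_polyC -scalerAr mulr1 scalerA -exprSr.
Qed.

Lemma cell_polyE delta f k j x : (cell_poly delta f k)^`(j).[x] =
  delta ^- j * \sum_(n < 5) fdiffn delta n f (delta * k%:~R)
                 * (blend n)^`(j).[(x - delta * k%:~R) / delta].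
Proof.
rewrite /cell_poly (raddf_sum (derivn j)) /= horner_sum mulr_sumr.
apply: eq_bigr => n _; rewrite derivnZ derivn_comp_affine !hornerZ.
rewrite horner_comp hornerZ hornerXsubC exprVn.
by rewrite (mulrC delta^-1) mulrCA.
Qed.

(** The boundary term u 5 * v 4 is the reason why c_4 has to be flat at 0: the
    fifth difference of f must not appear. *)
Lemma summation_by_parts5 (u v : nat -> R) : v 4%N = 0 ->
  \sum_(n < 5) u n * (v n + (if n : nat is m.+1 then v m else 0))
    = \sum_(n < 5) (u n + u n.+1) * v n.
Proof. by rewrite !big_ord_recr !big_ord0 /= => ->; ring. Qed.

(** Third-order contact of consecutive pieces: the rule for c_n at the right
    end of one cell is dual to the rule D_n + D_{n+1} for the differences at the
    left end of the next one. *)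
Lemma cell_poly_joined delta f k j : delta != 0 -> (j <= 3)%N ->
  (cell_poly delta f (k - 1))^`(j).[delta * k%:~R]
    = (cell_poly delta f k)^`(j).[delta * k%:~R].
Proof.
move=> d0 j3; rewrite !cell_polyE subrr mul0r.
have -> : (delta * k%:~R - delta * (k - 1)%:~R) / delta = 1.
  by rewrite intrB; field.
have D n : fdiffn delta n f (delta * k%:~R) =
    fdiffn delta n f (delta * (k - 1)%:~R)
      + fdiffn delta n.+1 f (delta * (k - 1)%:~R).
  by rewrite fdiffnS_grid subrK addrC subrK.
congr (_ * _); under eq_bigr do rewrite blend_step//.
under [RHS]eq_bigr do rewrite D.
exact: (@summation_by_parts5 (fun n => fdiffn delta n f _)
  (fun n => (blend n)^`(j).[0]) (blend4_flat j3)).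
Qed.

Lemma interpE delta f x : 0 < delta ->
  interp delta f x = local_poly delta f (cell delta x) x.
Proof. by move=> d0; rewrite local_polyE ?gt_eqF. Qed.

Lemma interp_piecewise delta f : 0 < delta ->
  interp delta f = piecewise delta (cell_poly delta f).
Proof.
move=> d0; apply/funext => x; rewrite interpE// local_poly_blend /piecewise.
by have := cell_polyE delta f (cell delta x) 0 x; rewrite expr0 invr1 mul1r.
Qed.

(** * Bounds for the pieces *)

Definition coef_norm (p : {poly R}) : R := \sum_(i < size p) `|p`_i|.

Lemma horner_le_coef_norm (p : {poly R}) t : 0 <= t <= 1 ->
  `|p.[t]| <= coef_norm p.
Proof.
move=> /andP[t0 t1]; rewrite horner_coef.
apply: le_trans (ler_norm_sum _ _ _) _.
apply: ler_sum => i _; rewrite normrM ler_piMr// ger0_norm ?exprn_ge0//.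
exact: exprn_ile1.
Qed.

Lemma fdiffn_bound delta f M m k :
  (forall i, (i <= m)%N -> `|f (delta * (k + i%:Z)%:~R)| <= M) ->
  `|fdiffn delta m f (delta * k%:~R)| <= 2 ^+ m * M.
Proof.
elim: m k => [|m IH] k fM.
  by rewrite expr0 mul1r -[k]addr0; exact: (fM 0%N).
rewrite fdiffnS_grid exprS -mulrA mulr_natl mulr2n.
apply: le_trans (ler_normB _ _) _; apply: lerD; apply: IH => i im.
  by rewrite -addrA -PoszD add1n; exact: fM.
by apply: fM; exact: leqW.
Qed.

(** Summing over all orders a <= 4 gives one constant for all of them; the 1
    makes it visibly positive. *)
Definition blend_bound : R :=
  1 + \sum_(a < 5) \sum_(n < 5) 2 ^+ n * coef_norm (blend n)^`(a).

Lemma coef_norm_ge0 p : 0 <= coef_norm p.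
Proof. by apply: sumr_ge0 => i _. Qed.

Lemma blend_bound_gt0 : 0 < blend_bound.
Proof.
apply: ltr_wpDr => //; apply: sumr_ge0 => a _; apply: sumr_ge0 => n _.
by rewrite mulr_ge0 ?exprn_ge0 ?coef_norm_ge0.
Qed.

(** Only the terms n >= a survive a derivations, and there the n-th difference
    of f is the (n - a)-th difference of the a-th one. *)
Lemma cell_poly_bound delta f k a x : 0 < delta -> (a <= 4)%N ->
  delta * k%:~R <= x < delta * (k + 1)%:~R ->
  `|(cell_poly delta f k)^`(a).[x]| <= blend_bound * delta ^- a *
    \big[Num.max/0]_(i < (4 - a).+1)
       `|fdiffn delta a f (delta * (k + i%:Z)%:~R)|.
Proof.
move=> d0 a4 /andP[kx xk]; set M := \big[_/_]_(_ < _) _.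
have M0 : 0 <= M by apply: bigmax_ge_id.
have MP i : (i <= 4 - a)%N ->
    `|fdiffn delta a f (delta * (k + i%:Z)%:~R)| <= M.
  rewrite -ltnS => ia.
  exact: (le_bigmax _ (fun i : 'I__ =>
    `|fdiffn delta a f (delta * (k + i%:Z)%:~R)|) (Ordinal ia)).
have t01 : 0 <= (x - delta * k%:~R) / delta <= 1.
  apply/andP; split; first by rewrite divr_ge0 ?subr_ge0// ltW.
  rewrite ler_pdivrMr// mul1r lerBlDl ltW// (lt_le_trans xk)//.
  by rewrite intrD mulrDr mulr1.
rewrite cell_polyE normrM ger0_norm ?invr_ge0 ?exprn_ge0 ?(ltW d0)//.
rewrite [blend_bound * _]mulrC -mulrA ler_pM2l ?invr_gt0 ?exprn_gt0//.
apply: (@le_trans _ _ ((\sum_(n < 5) 2 ^+ n * coef_norm (blend n)^`(a)) * M));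
  last first.
  have a5 : (a < 5)%N by [].
  apply: ler_wpM2r => //; apply: ler_wpDl => //.
  rewrite [leRHS](bigD1 (Ordinal a5))//= lerDl.
  apply: sumr_ge0 => b _; apply: sumr_ge0 => n _.
  by rewrite mulr_ge0 ?exprn_ge0 ?coef_norm_ge0.
apply: le_trans (ler_norm_sum _ _ _) _; rewrite mulr_suml.
apply: ler_sum => n _.
have [na|an] := ltnP n a.
  rewrite derivn_poly0 ?horner0 ?mulr0 ?normr0.
    by rewrite !mulr_ge0 ?exprn_ge0 ?coef_norm_ge0.
  apply: (leq_trans (size_blend _) na).
  by rewrite -ltnS (leq_trans na).
rewrite normrM mulrAC ler_pM ?horner_le_coef_norm//.
rewrite -{1}(subnK an) /fdiffn iterD -/(fdiffn delta (n - a) _).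
apply: le_trans (fdiffn_bound (M := M) _) _.
  move=> i ina; apply: MP; rewrite (leq_trans ina)// leq_sub2r//.
  by rewrite -ltnS.
by rewrite ler_wpM2r// ler_weXn2l ?leq_subr// ler1n.
Qed.

(** * The weights *)

(** The signed binomial coefficient of f (delta (k + i)) in the n-th difference
    of f at delta k. *)
Lemma indicator_fdiffn delta k (i n : nat) :
    delta != 0 -> (i < 5)%N -> (n < 5)%N ->
  fdiffn delta n (fun y => (y == delta * (k + i%:Z)%:~R)%:R) (delta * k%:~R)
    = (-1) ^+ (n + i) * 'C(n, i)%:R :> R.
Proof.
move=> d0; have [E1 E2 E3 E4] :=
  fdiffnE delta (fun y => (y == delta * (k + i%:Z)%:~R)%:R : R) k.
have E (l m : int) :
    (delta * (k + l)%:~R == delta * (k + m)%:~R :> R) = (l == m).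
  by rewrite (inj_eq (mulfI d0)) eqr_int (inj_eq (addrI k)).
have E0 : delta * k%:~R = delta * (k + 0)%:~R by rewrite addr0.
move=> i5; case: n => [|[|[|[|[|//]]]]] _;
  rewrite ?E1 ?E2 ?E3 ?E4 /fdiffn/= ?[X in X == _]E0 !E;
  by case: i i5 {E1 E2 E3 E4} => [|[|[|[|[|//]]]]] _ /=;
  rewrite exprD !binE /=; ring.
Qed.

Definition weight_poly (i : 'I_5) : {poly R} :=
  \sum_(n < 5) ((-1) ^+ (n + i) * 'C(n, i)%:R) *: blend n.

Lemma weightE delta k (i : 'I_5) x : delta != 0 ->
  weight delta k (k + i%:Z) x = (weight_poly i).[(x - delta * k%:~R) / delta].
Proof.
move=> d0; rewrite /weight local_poly_blend horner_sum; apply: eq_bigr => n _.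
by rewrite hornerZ indicator_fdiffn.
Qed.

(** The degree is that of c_4, which enters each weight with the nonzero
    coefficient (-1)^i 'C(4, i). *)
Lemma size_weight_poly i : size (weight_poly i) = 8%N.
Proof.
rewrite /weight_poly big_ord_recr /=.
have s4 : size (((-1) ^+ (4 + i) * 'C(4, i)%:R) *: blend 4) = 8%N.
  rewrite size_scale ?size_blend4// mulf_neq0 ?signr_eq0// pnatr_eq0 -lt0n.
  by rewrite bin_gt0 -ltnS.
rewrite addrC size_polyDl s4// ltnS; apply: (leq_trans (size_sum _ _ _)).
apply/bigmax_leqP => n _; apply: leq_trans (size_scale_leq _ _) _.
apply: leq_trans (size_blend _) _; first by rewrite -ltnS.
by rewrite (leq_trans (ltn_ord n)).
Qed.

Lemma local_poly_knot delta f k :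
  local_poly delta f k (delta * k%:~R) = f (delta * k%:~R).
Proof. by rewrite /local_poly subrr !mul0r !expr0n /=; ring. Qed.

End Blend.

(** * Regularity and bounds for the interpolant *)

Section Interpolant.
Context {R : realType}.
Variables (delta : R) (K : set R) (f : R -> R).
Hypotheses (delta0 : 0 < delta) (itvK : is_interval K).
Implicit Types (x : R).

Let A := K4 delta K.

Lemma K4_between a b x : A a -> A b -> a <= x <= b -> grid delta x -> A x.
Proof.
move=> [[Ka _] [Ka4 _]] [[Kb _] [Kb4 _]] /andP[ax xb] [k _ kx].
split; split.
- by apply: (itvK Ka Kb); rewrite ax.
- by exists k.
- by apply: (itvK Ka4 Kb4); rewrite !lerD2r ax.
- by exists (k + 4) => //; rewrite -kx; ring.
Qed.

Lemma K4_grid x : A x -> grid delta x. Proof. by case=> -[]. Qed.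

Lemma off_K4_off_grid x : Conv A x -> ~ A x -> ~ grid delta x.
Proof.
move=> /Conv_betweenP[a [b [Aa Ab axb]]] nAx gx.
by apply/nAx/(K4_between Aa Ab).
Qed.

(** A point of the hull off K_4 is off the grid and strictly between two points
    of K_4; moving it slightly keeps it inside its open cell. *)
Lemma off_K4_nbhs x : Conv A x -> ~ A x -> nbhs x (Conv A `\` A).
Proof.
move=> Ax nAx; have gx := off_K4_off_grid Ax nAx.
have /Conv_betweenP[a [b [Aa Ab /andP[ax xb]]]] := Ax.
have {}ax : a < x.
  by rewrite lt_neqAle ax andbT; apply/eqP => E; rewrite E in Aa.
have {}xb : x < b.
  by rewrite lt_neqAle xb andbT; apply/eqP => E; rewrite -E in Ab.
have kx : delta * (cell delta x)%:~R < x.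
  have /andP[kx _] := cell_itv delta0 x; rewrite lt_neqAle kx andbT.
  by apply/eqP => E; apply: gx; exists (cell delta x).
apply: filterS (filterI (near_cell delta0 x) (filterI (lt_nbhsr kx)
  (filterI (lt_nbhsr ax) (lt_nbhsl xb)))) => y [yx [ky [ay yb]]].
split; first by apply/Conv_betweenP; exists a, b; rewrite !ltW.
move=> /K4_grid[m _ yE]; case: yx => [|[xE _]]; last first.
  by apply: gx; exists (cell delta x).
by rewrite -yE cell_knot// => mE; move: ky; rewrite -yE mE ltxx.
Qed.

Definition interp_deriv (j : nat) : R -> R :=
  piecewise delta (fun k => (cell_poly delta f k)^`(j)).

Lemma interp_deriv_joined j x : (j <= 3)%N \/ ~ grid delta x ->
  joined_at delta x (fun k => (cell_poly delta f k)^`(j)).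
Proof.
move=> [j3 xE|/joined_at_off_grid//]; rewrite {2 4}xE.
by apply: cell_poly_joined; rewrite ?gt_eqF.
Qed.

Lemma interp_deriv_continuous j x : (j <= 3)%N \/ ~ grid delta x ->
  {for x, continuous (interp_deriv j)}.
Proof. by move=> jx; apply/piecewise_continuous/interp_deriv_joined. Qed.

Lemma interp_deriv_diff_quot j x : (j < 3)%N \/ ~ grid delta x ->
  diff_quot (interp_deriv j) x @ x^' --> interp_deriv j.+1 x.
Proof.
move=> jx; apply: piecewise_diff_quot => //.
  by apply: interp_deriv_joined; case: jx => [/ltnW|]; [left|right].
by apply: (@interp_deriv_joined j.+1); case: jx => [|]; [left|right].
Qed.

Lemma Conv_K4_limit_point a b x : A a -> A b -> a != b -> Conv A x ->
  limit_point (Conv A) x.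
Proof.
move=> Aa Ab ab Ax.
have iA : is_interval (Conv A).
  move=> u v /Conv_betweenP[c [d [Ac Ad /andP[cu ud]]]].
  move=> /Conv_betweenP[c' [d' [Ac' Ad' /andP[cv vd]]]] z /andP[uz zv].
  by apply/Conv_betweenP; exists c, d'; rewrite (le_trans cu) ?(le_trans zv).
have cA c : A c -> Conv A c.
  by move=> Ac; apply/Conv_betweenP; exists c, c; rewrite lexx.
have [ax|ax] := eqVneq a x; last exact: (interval_limit_point iA Ax (cA _ Aa)).
by apply: (interval_limit_point iA Ax (cA _ Ab)); rewrite -ax eq_sym.
Qed.

Lemma interp_smooth : smooth_on (Conv A `\` A) (interp delta f).
Proof.
move=> n; rewrite interp_piecewise//.
apply: (Cn_on_chain (G := interp_deriv)) =>
  [x [Ax nAx]|j x _ [Ax nAx]|j x _ [Ax nAx]].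
- exact/interior_limit_point/off_K4_nbhs.
- by apply: interp_deriv_diff_quot; right; exact: off_K4_off_grid.
- by apply: interp_deriv_continuous; right; exact: off_K4_off_grid.
Qed.

(** In a one-point hull the relative derivatives are zero by convention, so the
    piecewise formulas do not apply and this case has to be separated. *)
Lemma Conv_K4_dichotomy : (forall x, Conv A x -> limit_point (Conv A) x) \/
  (forall x y, Conv A x -> Conv A y -> x = y).
Proof.
have [[a [b [Aa Ab ab]]]|nA] := pselect (exists a b, [/\ A a, A b & a != b]).
  by left=> x; exact: Conv_K4_limit_point Aa Ab ab.
have A1 a b : A a -> A b -> a = b.
  by move=> Aa Ab; apply/eqP/negPn/negP => ab; apply: nA; exists a, b.
right=> x y /Conv_betweenP[a [b [Aa Ab]]]; rewrite (A1 b a)// => axa.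
move=> /Conv_betweenP[c [d [Ac Ad]]]; rewrite (A1 c a)// (A1 d a)// => aya.
by rewrite -(le_anti axa) -(le_anti aya).
Qed.

Lemma interp_C3 : Cn_on 3 (Conv A) (interp delta f).
Proof.
rewrite interp_piecewise//.
have [limA|A1] := Conv_K4_dichotomy; last exact: Cn_on_subsingleton.
apply: (Cn_on_chain (G := interp_deriv)) => // j x j3 _.
- by apply: interp_deriv_diff_quot; left.
- by apply: interp_deriv_continuous; left.
Qed.

(** The fourth derivative is the relative derivative, at a point off the grid,
    of the third one, which is known on the whole hull. *)
Lemma deriven_in_interp j x : (forall y, Conv A y -> limit_point (Conv A) y) ->
    (j <= 3)%N /\ Conv A x \/ j = 4%N /\ (Conv A `\` A) x ->
  deriven_in (Conv A) j (interp delta f) x = interp_deriv j x.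
Proof.
move=> limA jx; rewrite interp_piecewise//.
have E i : (i <= 3)%N ->
    {in Conv A, deriven_in (Conv A) i (interp_deriv 0) =1 interp_deriv i}.
  apply: deriven_in_chain => // l y l3 _.
  by apply: interp_deriv_diff_quot; left.
case: jx => [[j3 Ax]|[-> [Ax nAx]]]; first by rewrite -(E j)// inE.
apply: (deriven_in_next (E 3%N _)) => //; first exact: limA.
by apply: interp_deriv_diff_quot; right; exact: off_K4_off_grid.
Qed.

Lemma deriven_in_interp_bound j x :
    (j <= 3)%N /\ Conv A x \/ j = 4%N /\ (Conv A `\` A) x ->
  `|deriven_in (Conv A) j (interp delta f) x| <= blend_bound * delta ^- j *
    \big[Num.max/0]_(i < (4 - j).+1)
       `|fdiffn delta j f (delta * (cell delta x + i%:Z)%:~R)|.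
Proof.
move=> jx.
have j4 : (j <= 4)%N by case: jx => [[/leqW]|[->]].
have bound := cell_poly_bound f delta0 j4 (cell_itv delta0 x).
have [limA|A1] := Conv_K4_dichotomy; first by rewrite deriven_in_interp.
case: j => [|j] in jx j4 bound *; first by rewrite interp_piecewise.
rewrite deriven_in_isolated ?normr0; first exact: le_trans bound.
have Ax : Conv A x by case: jx => [[_]|[_ []]].
by move=> /(_ setT filterT)[y [/eqP yx Ay _]]; exact/yx/A1.
Qed.

End Interpolant.

Theorem theorem1 (R : realType) :
  (forall (delta : R) (K : set R) (f : R -> R),
     0 < delta -> is_interval K ->
     [/\ Cn_on 3 (Conv (K4 delta K)) (interp delta f),
         smooth_on (Conv (K4 delta K) `\` K4 delta K) (interp delta f) &
         forall k : int, K4 delta K (delta * k%:~R) ->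
           interp delta f (delta * k%:~R) = f (delta * k%:~R)])
  /\
  (exists C : R, 0 < C /\
     forall (delta : R) (K : set R) (f : R -> R),
     0 < delta -> is_interval K ->
     forall (a : nat) (x : R),
     ((a <= 3)%N /\ Conv (K4 delta K) x \/
      a = 4%N /\ (Conv (K4 delta K) `\` K4 delta K) x) ->
     `|deriven_in (Conv (K4 delta K)) a (interp delta f) x|
       <= C * delta ^- a *
          \big[Num.max/0]_(i < (4 - a).+1)
            `|fdiffn delta a f (delta * (cell delta x + i%:Z)%:~R)|)
  /\
  (exists p : 'I_5 -> {poly R},
     (forall i : 'I_5, size (p i) = 8%N) /\
     forall (delta : R), 0 < delta -> forall (k : int) (i : 'I_5) (x : R),
       weight delta k (k + i%:Z) x = (p i).[(x - delta * k%:~R) / delta])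
  /\
  (forall delta : R, 0 < delta ->
     [/\ forall k : int, weight delta k k (delta * k%:~R) = 1,
         forall (k : int) (i : 'I_5), (0 < i)%N ->
           weight delta k (k + i%:Z) (delta * k%:~R) = 0,
         forall (k : int) (x : R),
           \sum_(i < 5) weight delta k (k + i%:Z) x = 1 &
         forall (j k : int) (i : 'I_5) (x : R),
           weight delta (k + j) (k + j + i%:Z) (x + delta * j%:~R)
           = weight delta k (k + i%:Z) x]).
Proof.
split; [|split; [|split]].
- move=> delta K f d0 iK; split; [exact: interp_C3|exact: interp_smooth|].
  by move=> k _; rewrite interpE// cell_knot// local_poly_knot.
- exists blend_bound; split; first exact: blend_bound_gt0.
  by move=> delta K f d0 iK a x; exact: deriven_in_interp_bound.
- exists weight_poly; split; first exact: size_weight_poly.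
  by move=> delta d0 k i x; rewrite weightE ?gt_eqF.
move=> delta d0; have dn0 : delta != 0 by rewrite gt_eqF.
split.
- by move=> k; rewrite /weight local_poly_knot eqxx.
- move=> k i i0; rewrite /weight local_poly_knot.
  rewrite (inj_eq (mulfI dn0)) eqr_int -{1}[k]addr0 (inj_eq (addrI k)).
  by case: i i0 => -[].
- move=> k x; have := local_polyE (fun=> 1) k x dn0.
  under eq_bigr do rewrite mulr1.
  move=> <-; rewrite /local_poly /fdiffn /= /fdiff; ring.
- move=> j k i x; rewrite !weightE//; congr (_.[_ / _]).
  by rewrite intrD mulrDr opprD addrACA subrr addr0.
Qed.
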